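(* Let $q\in L^1_{\mathrm{loc}}(\mathbb R)$ and let $N(q)=i\begin{pmatrix}\frac{d}{dx}&-q\\\overline q&\frac{d}{dx}\end{pmatrix}$ with maximal operator $\widetilde D_{\max}(q)$ in $L^2(\mathbb R)^2$ (defined by $F\mapsto N(q)F$ on $\{F\in L^2(\mathbb R)^2\cap AC_{\mathrm{loc}}(\mathbb R)^2: N(q)F\in L^2(\mathbb R)^2\}$). Then: (i) As differential expressions, $M(-q)M(q)=N(q)^2$. (ii) Let $U_q$ be the $2\times2$ matrix solution of $U_q'=\begin{pmatrix}0&q\\-\overline q&0\end{pmatrix}U_q$, $U_q(0)=I_2$. Then $U_q(x)$ is unitary for every $x\in\mathbb R$, its entries lie in $AC_{\mathrm{loc}}(\mathbb R)\cap L^\infty(\mathbb R)$, and $U_q^{-1}N(q)U_q=i\frac{d}{dx}I_2$. (iii) With $\mathcal U_q$ the operator of multiplication by $U_q(\cdot)$ on $L^2(\mathbb R)^2$, $\mathcal U_q^{-1}\widetilde D_{\max}(q)\mathcal U_q=\big(i\frac{d}{dx}I_2\big)_{\max}$ with domain $H^{1,2}(\mathbb R)^2=\{F\in L^2\cap AC_{\mathrm{loc}}: F'\in L^2\}$, and $\mathcal U_q^{-1}D_{\max}(-q)D_{\max}(q)\mathcal U_q=\big(-\frac{d^2}{dx^2}I_2\big)_{\max}$ with domain $H^{2,2}(\mathbb R)^2=\{F\in L^2(\mathbb R)^2: F,F'\in AC_{\mathrm{loc}}(\mathbb R)^2,\ F',F''\in L^2(\mathbb R)^2\}$.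
   Context: $M(q)=i\begin{pmatrix}\frac{d}{dx}&-q\\-\overline q&-\frac{d}{dx}\end{pmatrix}$ and $D_{\max}(q)F=M(q)F$ on $\{F\in L^2(\mathbb R)^2: F\in AC_{\mathrm{loc}}(\mathbb R)^2,\ M(q)F\in L^2(\mathbb R)^2\}$. *)

(* Defs.v *)
From HB Require Import structures.
From mathcomp Require Import all_boot all_order all_algebra.
From mathcomp Require Import all_classical all_reals all_analysis.
From mathcomp Require Import complex.
Set Implicit Arguments. Unset Strict Implicit. Unset Printing Implicit Defensive.
Import Order.TTheory GRing.Theory Num.Theory.
Import numFieldNormedType.Exports.
Local Open Scope classical_set_scope.
Local Open Scope ring_scope.

Section Defs.
Variable R : realType.
Local Notation C := R[i].
Local Notation mu := (@lebesgue_measure R).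
Local Notation V := ('cV[C]_2).

Definition c0 (v : V) : C := v ord0 ord0.
Definition c1 (v : V) : C := v ord_max ord0.
Definition col2 (a b : C) : V := \col_(i < 2) (if i == ord0 then a else b).
Definition mx2 (a b c d : C) : 'M[C]_2 :=
  \matrix_(i < 2, j < 2)
    (if i == ord0 then (if j == ord0 then a else b)
     else (if j == ord0 then c else d)).

Definition iC : C := Complex 0 1.

Definition cabs (z : C) : R := ComplexField.Normc.normc z.

Definition adjmx (M : 'M[C]_2) : 'M[C]_2 := map_mx (@conjc R) M^T.
Definition unitary_mx (M : 'M[C]_2) :=
  adjmx M *m M = 1%:M /\ M *m adjmx M = 1%:M.

Definition loc_int (f : R -> C) :=
  locally_integrable setT (fun x => complex.Re (f x)) /\
  locally_integrable setT (fun x => complex.Im (f x)).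

Definition cint (a b : R) (g : R -> C) : C :=
  Complex (Rintegral mu `[a, b] (fun x => complex.Re (g x)))
          (Rintegral mu `[a, b] (fun x => complex.Im (g x))).

(* f in AC_loc(R) with (a.e.) derivative g, i.e. f is an indefinite
   integral of the locally integrable function g *)
Definition acl_deriv (f g : R -> C) :=
  loc_int g /\ forall a b, a <= b -> f b - f a = cint a b g.

Definition acl_derivv (F G : R -> V) :=
  forall i : 'I_2, acl_deriv (fun x => F x i ord0) (fun x => G x i ord0).

Definition L2c (f : R -> C) :=
  [/\ measurable_fun setT (fun x => complex.Re (f x)),
      measurable_fun setT (fun x => complex.Im (f x)) &
      (\int[mu]_x ((complex.Re (f x)) ^+ 2 + (complex.Im (f x)) ^+ 2)%:E < +oo)%E].

Definition L2v (F : R -> V) := forall i : 'I_2, L2c (fun x => F x i ord0).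

Definition aeeq (F G : R -> V) := {ae mu, forall x, F x = G x}.

Definition Mop (q : R -> C) (F dF : R -> V) (x : R) : V :=
  iC *: col2 (c0 (dF x) - q x * c1 (F x)) (- conjc (q x) * c0 (F x) - c1 (dF x)).
Definition Nop (q : R -> C) (F dF : R -> V) (x : R) : V :=
  iC *: col2 (c0 (dF x) - q x * c1 (F x)) (conjc (q x) * c0 (F x) + c1 (dF x)).
Definition iDop (F dF : R -> V) (x : R) : V := iC *: dF x.

Definition dexpr (E : (R -> V) -> (R -> V) -> R -> V) (F Y : R -> V) :=
  exists dF, acl_derivv F dF /\ aeeq Y (E F dF).

Definition dexpr2 (E1 E2 : (R -> V) -> (R -> V) -> R -> V) (F Z : R -> V) :=
  exists Y, dexpr E2 F Y /\ dexpr E1 Y Z.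

Definition d2expr (F Z : R -> V) :=
  exists dF ddF, [/\ acl_derivv F dF, acl_derivv dF ddF &
                     aeeq Z (fun x => - ddF x)].

(* maximal operator in L^2(R)^2 of a differential expression (as a graph on
   representatives): F, G in L^2, F has an AC_loc representative F0 and
   G = E F0 a.e. *)
Definition maxop (P : (R -> V) -> (R -> V) -> Prop) (F G : R -> V) :=
  [/\ L2v F, L2v G & exists F0, aeeq F F0 /\ P F0 G].

Definition opcomp (A B : (R -> V) -> (R -> V) -> Prop) (F Z : R -> V) :=
  exists Y, B F Y /\ A Y Z.

Definition H12 (F : R -> V) :=
  L2v F /\ exists F0 dF, [/\ aeeq F F0, acl_derivv F0 dF & L2v dF].
Definition H22 (F : R -> V) :=
  L2v F /\ exists F0 dF ddF,
    [/\ aeeq F F0, acl_derivv F0 dF, acl_derivv dF ddF, L2v dF & L2v ddF].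

Definition Aq (q : R -> C) (x : R) : 'M[C]_2 := mx2 0 (q x) (- conjc (q x)) 0.

Definition mulU (U : R -> 'M[C]_2) (F : R -> V) : R -> V := fun x => U x *m F x.

End Defs.

(* Main.v *)
(* Set A = [[0, q], [- conj q, 0]]. Then N(q) F = i (F' - A F), so the product
   rule for locally absolutely continuous functions gives N(q) (U F) = i U F' for
   a solution of U' = A U. Since A is skew-Hermitian, U^* U has zero derivative,
   and hence U is unitary. The sign change s = diag(1, -1) satisfies
   M(q) = s N(q) and M(-q) s = N(q), which turns M(-q) M(q) into N(q)^2.
   Composing the maximal operator i d/dx with itself yields exactly the maximal
   operator -d^2/dx^2, because f, f'' in L^2 forces f' in L^2. *)
Require Import Defs.
From HB Require Import structures.
From mathcomp Require Import all_boot all_order all_algebra.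
From mathcomp Require Import all_classical all_reals all_analysis.
From mathcomp Require Import measurable_realfun.
From mathcomp Require Import complex ring lra.
Set Implicit Arguments. Unset Strict Implicit. Unset Printing Implicit Defensive.
Import Order.TTheory GRing.Theory Num.Theory.
Import numFieldNormedType.Exports.
Local Open Scope classical_set_scope.
Local Open Scope ring_scope.

(** The obstacle is the product rule. Absolute continuity is given here by the identity f b - f a =
    integral of f' over [a, b], with f' fixed only up to a null set, so the argument works with
    increments rather than with pointwise derivatives. The increments of f g minus the integral of
    f' g + f g' are bounded by the squared increments of one continuous nondecreasing function, and
    repeated bisection along the values of that function forces such a difference to vanish. The
    other analytic input, f' in L^2, comes from a Caccioppoli estimate whose constant does not
    depend on the length of the interval. The operators are relations between representatives, so
    that each factorisation or conjugation becomes a transport of the intermediate function of a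
    composition: by s for the sign change, by U and its adjoint for the unitary equivalence.
    Transport back by the adjoint V of U rests on V being locally absolutely continuous as well,
    with V' = - V A. *)

Section LocallyIntegrable.
Context {R : realType}.
Local Notation mu := (@lebesgue_measure R).
Implicit Types (f g : R -> R) (a b c : R).

(** Every compact subset of the line lies in a segment, so segments suffice. This is the form in
    which integrability goals are discharged below. *)
Lemma locally_integrableTP f : locally_integrable setT f <->
  measurable_fun setT f /\ forall a b, mu.-integrable `[a, b] (EFin \o f).
Proof.
split=> [[mf _ fK]|[mf fi]]; first split=> // a b.
  apply/integrableP; split; last by apply: fK => //; exact: segment_compact.
  by apply/measurable_EFinP; exact: measurable_funTS.
split=> //; first exact: openT.
(* [compact_bounded] only yields bounds strictly beyond [M], hence the radius [|M| + 1]. *)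
move=> K _ cK; have [M [_ /(_ (`|M| + 1)) KM]] := compact_bounded cK.
have {KM}KM : K `<=` `[- (`|M| + 1), `|M| + 1].
  move=> x /KM; rewrite /= in_itv /= -ler_norml; apply.
  by rewrite (le_lt_trans (ler_norm M))// ltrDl.
have /integrableP[_] := fi (- (`|M| + 1)) (`|M| + 1).
apply: le_lt_trans; apply: ge0_subset_integral => //.
- exact: compact_measurable.
- by do 2 apply: measurableT_comp => //; exact: measurable_funTS.
Qed.

Lemma continuous_locally_integrable f :
  continuous f -> locally_integrable setT f.
Proof.
move=> cf; apply/locally_integrableTP; split.
  exact: continuous_measurable_fun.
move=> a b; apply: continuous_compact_integrable; first exact: segment_compact.
exact: continuous_subspaceT.
Qed.

Lemma locally_integrableMl f g : continuous f -> locally_integrable setT g ->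
  locally_integrable setT (f \* g).
Proof.
move=> cf /locally_integrableTP[mg ig]; apply/locally_integrableTP; split.
  by apply: measurable_funM => //; exact: continuous_measurable_fun.
move=> a b; have mf := continuous_measurable_fun cf.
have cfab : {within `[a, b], continuous f} by exact: continuous_subspaceT.
have := continuous_compact cfab (@segment_compact _ a b).
move=> /compact_bounded[M [Mr MP]].
apply: (@integrableMr _ _ _ mu `[a, b] _ f (EFin \o g)) => //.
  exact: measurable_funTS.
exists M; split=> // x Mx y yab; apply: (MP x Mx); exists y => //.
Qed.

Lemma locally_integrableMr f g : locally_integrable setT f -> continuous g ->
  locally_integrable setT (f \* g).
Proof.
move=> lf cg; rewrite (_ : f \* g = g \* f); first exact: locally_integrableMl.
by apply/funext => x /=; rewrite mulrC.
Qed.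

Lemma locally_integrable_norm f : locally_integrable setT f ->
  locally_integrable setT (fun x => `|f x|).
Proof.
move=> /locally_integrableTP[mf lf]; apply/locally_integrableTP; split.
  exact: measurableT_comp.
by move=> a b; have := integrable_norm (lf a b).
Qed.

Lemma Rintegral_itv_add f a b c : mu.-integrable `[a, c] (EFin \o f) ->
  a <= b -> b <= c ->
  \int[mu]_(t in `[a, c]) f t =
  \int[mu]_(t in `[a, b]) f t + \int[mu]_(t in `[b, c]) f t.
Proof.
move=> fi ab bc; apply/eqP; rewrite addrC -subr_eq; apply/eqP.
rewrite (Rintegral_itvB fi) ?bnd_simp// Rintegral_itv_obnd_cbnd//.
apply: integrableS fi => //.
by apply: subset_itv; rewrite bnd_simp.
Qed.

End LocallyIntegrable.

(** * Constancy from quadratically small increments *)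

Section QuadraticIncrements.
Context {R : realType}.

(* Splitting [[x, y]] where [P] takes the value [(P x + P y) / 2] halves the bound
   on [h y - h x], arbitrarily often. *)
Lemma eq_of_quadratic_increments (h P : R -> R) a b : a <= b ->
  {within `[a, b], continuous P} ->
  (forall x y, a <= x -> x <= y -> y <= b -> P x <= P y) ->
  (forall x y, a <= x -> x <= y -> y <= b ->
     `|h y - h x| <= (P y - P x) ^+ 2) ->
  h b = h a.
Proof.
move=> ab cP mP hP.
have halving n : forall x y, a <= x -> x <= y -> y <= b ->
    `|h y - h x| <= (P y - P x) ^+ 2 / 2 ^+ n.
  elim: n => [|n IH] x y ax xy yb; first by rewrite expr0 divr1; exact: hP.
  have cPxy : {within `[x, y], continuous P}.
    by apply: continuous_subspaceW cP; apply: subset_itv; rewrite bnd_simp.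
  have Pxy := mP _ _ ax xy yb.
  have [] := @IVT R P x y ((P x + P y) / 2) xy cPxy.
    by rewrite /Num.min /Num.max; case: ltP => ?; apply/andP; split; lra.
  move=> c; rewrite in_itv /= => /andP[xc cy] Pc.
  have := IH _ _ ax xc (le_trans cy yb).
  have := IH _ _ (le_trans ax xc) cy yb.
  (* Each piece has half the increment of [P], so the two squares are quarters and together give the
     new factor 1/2. *)
  have -> : h y - h x = (h y - h c) + (h c - h x) by ring.
  move=> h1 h2; apply: (le_trans (ler_normD _ _)); apply: (le_trans (lerD h1 h2)).
  rewrite Pc (exprS 2 n) le_eqVlt; apply/orP; left; apply/eqP.
  by field; rewrite expf_neq0.
apply/eqP; rewrite -subr_eq0 -normr_eq0; apply/negP => /negP.
rewrite neq_lt normr_lt0 /= => e0.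
(* The quotient of the initial bound by the supposedly nonzero increment lies below [n], and n < 2^n
   contradicts [halving]. *)
pose n := (Num.truncn ((P b - P a) ^+ 2 / `|h b - h a|)).+1.
have := halving n a b (lexx _) ab (lexx _); rewrite leNgt => /negP; apply.
rewrite ltr_pdivrMr ?exprn_gt0// mulrC -ltr_pdivrMr//.
apply: (lt_trans (truncnS_gt _)); rewrite -natrX ltr_nat; exact: ltn_expl.
Qed.
End QuadraticIncrements.

(** * Real locally absolutely continuous functions and their product rule *)

Section AbsolutelyContinuous.
Context {R : realType}.
Local Notation mu := (@lebesgue_measure R).
Implicit Types (f g df dg : R -> R) (a b c : R).

(** Real counterpart of [acl_deriv]: the derivative is an explicit datum, and [ac_ae] allows it to
    be changed on a null set. *)
Definition ac_with f df := locally_integrable setT df /\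
  forall a b, a <= b -> f b - f a = \int[mu]_(x in `[a, b]) df x.

(* Resolution of the filter instance of [almost_everywhere mu] fails for the
   semiring structure in which the statement elaborates, so [filterS] is not usable here. *)
Lemma ae_mono (P Q : R -> Prop) : (forall x, P x -> Q x) ->
  {ae mu, forall x, P x} -> {ae mu, forall x, Q x}.
Proof. by move=> PQ; apply: negligibleS => x /= nQ /PQ. Qed.

Lemma ae_mono2 (P Q S : R -> Prop) : (forall x, P x -> Q x -> S x) ->
  {ae mu, forall x, P x} -> {ae mu, forall x, Q x} -> {ae mu, forall x, S x}.
Proof.
move=> PQS aP aQ; have := negligibleU aP aQ; apply: negligibleS => x /= nS.
have [Px|] := pselect (P x); last by left.
by right => Qx; apply: nS; exact: PQS.
Qed.

Lemma locally_integrable_itv f a b : locally_integrable setT f ->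
  mu.-integrable `[a, b] (EFin \o f).
Proof. by move=> /locally_integrableTP[_]. Qed.

Lemma ac_continuous f df : ac_with f df -> continuous f.
Proof.
move=> [ldf fE] x; have x1 : x - 1 < x + 1 by lra.
apply: (within_continuous_continuous x1); last by rewrite in_itv /=; lra.
apply: (@subspace_eq_continuous _ _ _
  (fun t => f (x - 1) + parameterized_integral mu (x - 1) t df)).
  move=> t; rewrite inE /= in_itv /= => /andP[xt _].
  by rewrite /from_subspace /= /parameterized_integral -fE//; ring.
move=> t; apply: cvgD; first exact: cvg_cst.
apply: parameterized_integral_continuous; first exact: ltW.
exact: locally_integrable_itv.
Qed.

Lemma ac_measurable f df : ac_with f df -> measurable_fun setT f.
Proof. by move=> /ac_continuous; exact: continuous_measurable_fun. Qed.

Lemma ac_cst c : ac_with (fun=> c) (fun=> 0).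
Proof.
split; first by apply: continuous_locally_integrable => x; exact: cvg_cst.
by move=> a b ab; rewrite Rintegral_cst// mul0r subrr.
Qed.

Lemma ac_id : ac_with id (fun=> 1).
Proof.
split; first by apply: continuous_locally_integrable => x; exact: cvg_cst.
move=> a b ab; rewrite Rintegral_cst// mul1r /= lebesgue_measure_itv /=.
rewrite lte_fin; case: ltP => [//|ba].
by rewrite (@le_anti _ _ a b) ?ab// subrr.
Qed.

Lemma acD f g df dg : ac_with f df -> ac_with g dg ->
  ac_with (fun x => f x + g x) (fun x => df x + dg x).
Proof.
move=> [lf fE] [lg gE]; split; first exact: locally_integrableD.
move=> a b ab; rewrite RintegralD//; try exact: locally_integrable_itv.
by rewrite -fE// -gE//; ring.
Qed.

Lemma acN f df : ac_with f df -> ac_with (fun x => - f x) (fun x => - df x).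
Proof.
move=> [lf fE]; split; first exact: locally_integrableN.
move=> a b ab; under eq_Rintegral do rewrite -mulN1r.
rewrite RintegralZl//; last exact: locally_integrable_itv.
by rewrite -fE//; ring.
Qed.

Lemma acB f g df dg : ac_with f df -> ac_with g dg ->
  ac_with (fun x => f x - g x) (fun x => df x - dg x).
Proof. by move=> hf hg; apply: acD => //; exact: acN. Qed.

(** Replaces a derivative by a better representative, for instance one that is itself absolutely
    continuous. Measurability of [dg] is assumed because changing a Borel function on a null set can
    destroy it. *)
Lemma ac_ae f df dg : ac_with f df -> measurable_fun setT dg ->
  {ae mu, forall x, df x = dg x} -> ac_with f dg.
Proof.
move=> [/locally_integrableTP[mdf idf] fE] mdg dfg.
have dfgI a b : ae_eq mu `[a, b]%classic (EFin \o df) (EFin \o dg).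
  by apply: ae_mono dfg => x /= ->.
split; last first.
  move=> a b ab; rewrite fE// /Rintegral; congr fine.
  by apply: ae_eq_integral => //; apply/measurable_EFinP; exact: measurable_funTS.
apply/locally_integrableTP; split=> // a b.
have /integrableP[m1 i1] := idf a b.
apply/integrableP; split; first by apply/measurable_EFinP; exact: measurable_funTS.
apply: le_lt_trans i1; rewrite le_eqVlt; apply/orP; left; apply/eqP.
apply: ae_eq_integral => //;
  try by apply: measurableT_comp => //; apply/measurable_EFinP; exact: measurable_funTS.
by apply: ae_eq_sym; exact: ae_eq_abse.
Qed.

Lemma Rintegral_mul_bound f g a b (K : R) :
  locally_integrable setT f -> continuous g ->
  (forall x, a <= x -> x <= b -> `|g x| <= K) ->
  `|\int[mu]_(x in `[a, b]) (f x * g x)| <=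
  (\int[mu]_(x in `[a, b]) `|f x|) * K.
Proof.
move=> lf cg gK; have lfg := locally_integrableMr lf cg.
apply: (le_trans (le_normr_Rintegral _ _)) => //.
  exact: (locally_integrable_itv a b lfg).
rewrite -RintegralZr//; last exact/locally_integrable_itv/locally_integrable_norm.
apply: le_Rintegral => //.
- by apply: locally_integrable_itv; exact: (locally_integrable_norm lfg).
- apply: (@locally_integrable_itv (fun x => `|f x| * K)).
  apply: (@locally_integrableMr _ (fun x => `|f x|) (cst K)).
    exact: locally_integrable_norm.
  by move=> x; exact: cvg_cst.
- move=> x; rewrite /= in_itv /= => /andP[ax xb].
  by rewrite normrM ler_wpM2l// gK.
Qed.

Lemma ac_increment_le f df a b x y : ac_with f df -> a <= x -> x <= y -> y <= b ->
  `|f y - f x| <= \int[mu]_(t in `[a, b]) `|df t|.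
Proof.
move=> [ldf fE] ax xy yb; rewrite fE//.
have ladf := locally_integrable_norm ldf.
apply: (le_trans (le_normr_Rintegral _ _)) => //; first exact: locally_integrable_itv.
rewrite (@Rintegral_itv_add _ _ a x b) ?(le_trans xy)//;
  last exact: locally_integrable_itv.
rewrite (@Rintegral_itv_add _ _ x y b)//; last exact: locally_integrable_itv.
by rewrite addrCA lerDl addr_ge0// Rintegral_ge0.
Qed.

(* On [[x, y]] the increment of [f g] minus the integral of [f' g + f g'] equals
   [int f'(t) (g y - g t) dt + int g'(t) (f x - f t) dt], hence is at most
   [(int (|f'| + |g'|))^2] *)
Lemma acM f g df dg : ac_with f df -> ac_with g dg ->
  ac_with (fun x => f x * g x) (fun x => df x * g x + f x * dg x).
Proof.
move=> hf hg; have [lf fE] := hf; have [lg gE] := hg.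
have cf := ac_continuous hf; have cg := ac_continuous hg.
have lfg := locally_integrableMr lf cg.
have lgf := locally_integrableMl cf lg.
have lk : locally_integrable setT (fun x => df x * g x + f x * dg x).
  exact: locally_integrableD.
have lp : locally_integrable setT (fun x => `|df x| + `|dg x|).
  by apply: locally_integrableD; exact: locally_integrable_norm.
split=> // a b ab.
pose h t := f t * g t - \int[mu]_(x in `[a, t]) (df x * g x + f x * dg x).
suff : h b = h a.
  by rewrite /h set_itv1 Rintegral_set1 => hE; lra.
(* Continuous and nondecreasing, with increment over [x, y] equal to the sum of the integrals of
   |f'| and |g'|; twice the product of these two integrals is what bounds the increment of [h]. *)
pose P t := \int[mu]_(x in `[a, t]) (`|df x| + `|dg x|).
have PE x y : a <= x -> x <= y ->
    P y - P x = \int[mu]_(t in `[x, y]) `|df t| + \int[mu]_(t in `[x, y]) `|dg t|.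
  move=> ax xy; rewrite -RintegralD//;
    try by apply: locally_integrable_itv; exact: locally_integrable_norm.
  rewrite /P (@Rintegral_itv_add _ _ a x y)//; last exact: locally_integrable_itv.
  by rewrite addrAC subrr add0r.
apply: (@eq_of_quadratic_increments _ h P a b ab).
- exact: (@parameterized_integral_continuous _ a b _ ab (locally_integrable_itv a b lp)).
- move=> x y ax xy yb; rewrite -subr_ge0 PE//.
  by rewrite addr_ge0// Rintegral_ge0.
move=> x y ax xy yb; rewrite PE//.
set A := \int[mu]_(t in _) `|df t|; set B := \int[mu]_(t in _) `|dg t|.
have A0 : 0 <= A by exact: Rintegral_ge0.
have B0 : 0 <= B by exact: Rintegral_ge0.
have cgy : continuous (fun t => g y - g t).
  by move=> t; apply: cvgB; [exact: cvg_cst | exact: cg].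
have cfx : continuous (fun t => f x - f t).
  by move=> t; apply: cvgB; [exact: cvg_cst | exact: cf].
have hE : h y - h x = \int[mu]_(t in `[x, y]) (df t * (g y - g t)) +
                      \int[mu]_(t in `[x, y]) (dg t * (f x - f t)).
  have -> : h y - h x = f y * g y - f x * g x -
      \int[mu]_(x in `[x, y]) (df x * g x + f x * dg x).
    rewrite /h (@Rintegral_itv_add _ _ a x y)//; last exact: locally_integrable_itv.
    by ring.
  have -> : f y * g y - f x * g x = (f y - f x) * g y + (g y - g x) * f x by ring.
  rewrite fE// gE// -RintegralZr//; last exact: locally_integrable_itv.
  rewrite -RintegralZr//; last exact: locally_integrable_itv.
  have icst k c : locally_integrable setT k -> mu.-integrable `[x, y] (EFin \o (fun t => k t * c)).
    move=> lk'; apply: locally_integrable_itv.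
    by apply: (@locally_integrableMr _ k (cst c)) => // z; exact: cvg_cst.
  have i1 := icst df (g y) lf; have i2 := icst dg (f x) lg.
  rewrite -(RintegralD _ i1 i2)// -RintegralB//; last 2 first.
  - by have := integrableD _ i1 i2; apply.
  - exact: locally_integrable_itv.
  rewrite -RintegralD//; try exact/locally_integrable_itv/locally_integrableMr.
  by apply: eq_Rintegral => t _; ring.
rewrite hE; apply: (le_trans (ler_normD _ _)).
apply: (@le_trans _ _ (A * B + B * A)).
  apply: lerD; apply: Rintegral_mul_bound => // t xt ty.
    exact: (ac_increment_le hg).
  by rewrite distrC; exact: (ac_increment_le hf).
by rewrite sqrrD -subr_ge0; have := sqr_ge0 A; have := sqr_ge0 B; nra.
Qed.

End AbsolutelyContinuous.

(** * Square integrability, and the L^2 bound on a first derivative *)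

Section SquareIntegrable.
Context {R : realType}.
Local Notation mu := (@lebesgue_measure R).
Implicit Types (f g h df dg : R -> R).

Definition square_integrable f := measurable_fun setT f /\
  (\int[mu]_x (f x ^+ 2)%:E < +oo)%E.

Lemma measurable_EFin_sqr f (D : set R) : measurable_fun setT f ->
  measurable_fun D (fun x => (f x ^+ 2)%:E).
Proof.
by move=> mf; apply/measurable_EFinP; apply: measurable_funTS; exact: measurable_funX.
Qed.

Lemma square_integrable_le f g : measurable_fun setT f -> square_integrable g ->
  (forall x, f x ^+ 2 <= g x ^+ 2) -> square_integrable f.
Proof.
move=> mf [mg ig] fg; split=> //; apply: le_lt_trans ig.
apply: ge0_le_integral => //; try exact: measurable_EFin_sqr.
- by move=> x _; rewrite lee_fin sqr_ge0.
- by move=> x _; rewrite lee_fin.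
Qed.

Lemma square_integrableN f : square_integrable f -> square_integrable (fun x => - f x).
Proof.
move=> [mf fi]; split; first exact: measurableT_comp.
by under eq_integral do rewrite sqrrN.
Qed.

Lemma square_integrableD f g : square_integrable f -> square_integrable g ->
  square_integrable (fun x => f x + g x).
Proof.
move=> [mf fi] [mg gi]; split; first exact: measurable_funD.
apply: (@le_lt_trans _ _ (\int[mu]_x (2%:E * (f x ^+ 2)%:E + 2%:E * (g x ^+ 2)%:E))%E).
  apply: ge0_le_integral => //.
  - by move=> x _; rewrite lee_fin sqr_ge0.
  - by apply: measurable_EFin_sqr; exact: measurable_funD.
  - by apply: emeasurable_funD; apply: measurable_funeM; exact: measurable_EFin_sqr.
  - move=> x _; rewrite lee_fin -subr_ge0; have := sqr_ge0 (f x - g x); nra.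
rewrite ge0_integralD//; last 4 first.
- by move=> x _; rewrite lee_fin mulr_ge0// sqr_ge0.
- by apply: measurable_funeM; exact: measurable_EFin_sqr.
- by move=> x _; rewrite lee_fin mulr_ge0// sqr_ge0.
- by apply: measurable_funeM; exact: measurable_EFin_sqr.
rewrite !ge0_integralZl//; try exact: measurable_EFin_sqr;
  try by move=> x _; rewrite lee_fin sqr_ge0.
by rewrite lte_add_pinfty// lte_mul_pinfty.
Qed.

Lemma square_integrable_boundedM f g (K : R) : measurable_fun setT f ->
  (forall x, `|f x| <= K) -> square_integrable g ->
  square_integrable (fun x => f x * g x).
Proof.
move=> mf fK [mg gi]; have K0 : 0 <= K by apply: le_trans (fK 0).
apply: (@square_integrable_le _ (fun x => K * g x)).
- exact: measurable_funM.
- split; first exact: measurable_funM.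
  under eq_integral do rewrite exprMn EFinM.
  rewrite ge0_integralZl//; [|exact: measurable_EFin_sqr|
    by move=> x _; rewrite lee_fin sqr_ge0|by rewrite lee_fin sqr_ge0].
  by rewrite lte_mul_pinfty// lee_fin sqr_ge0.
- move=> x; rewrite !exprMn ler_wpM2r ?sqr_ge0//.
  by have := fK x; rewrite ler_norml => /andP[]; nra.
Qed.

Lemma square_integrable_ae f g : measurable_fun setT g -> square_integrable f ->
  {ae mu, forall x, f x = g x} -> square_integrable g.
Proof.
move=> mg [mf fi] fg; split=> //; apply: le_lt_trans fi.
rewrite le_eqVlt; apply/orP; left; apply/eqP; apply: ae_eq_integral => //;
  try exact: measurable_EFin_sqr.
by apply: ae_mono fg => x -> _.
Qed.

Lemma square_integrable_sqr f : square_integrable f ->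
  mu.-integrable setT (EFin \o (fun x => f x ^+ 2)).
Proof.
move=> [mf fi]; apply/integrableP; split; first exact: measurable_EFin_sqr.
by under eq_integral do rewrite /= ger0_norm ?sqr_ge0//.
Qed.

Lemma continuous_sqr f : continuous f -> continuous (fun x => f x ^+ 2).
Proof. by move=> cf x; under eq_fun do rewrite expr2; apply: cvgM; exact: cf. Qed.

Lemma integrable_EFinZl f (k : R) (D : set R) : measurable D ->
  mu.-integrable D (EFin \o f) -> mu.-integrable D (EFin \o (fun x => k * f x)).
Proof. by move=> mD fi; have := fun mD' => integrableZl mD' k fi; apply. Qed.

Lemma integrable_EFinD f g (D : set R) : measurable D ->
  mu.-integrable D (EFin \o f) -> mu.-integrable D (EFin \o g) ->
  mu.-integrable D (EFin \o (fun x => f x + g x)).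
Proof. by move=> mD fi gi; have := fun mD' => integrableD mD' fi gi; apply. Qed.

Lemma EFin_Rintegral f (D : set R) : measurable D -> mu.-integrable D (EFin \o f) ->
  (\int[mu]_(x in D) f x)%:E = (\int[mu]_(x in D) (f x)%:E)%E.
Proof. by move=> mD fi; rewrite fineK//; exact: integrable_fin_num. Qed.

Lemma Rintegral_ge0_subset f (A B : set R) : measurable A -> measurable B ->
  A `<=` B -> mu.-integrable B (EFin \o f) -> (forall x, 0 <= f x) ->
  \int[mu]_(x in A) f x <= \int[mu]_(x in B) f x.
Proof.
move=> mA mB AB fi f0; rewrite -lee_fin !EFin_Rintegral//; last first.
  exact: integrableS fi.
apply: ge0_subset_integral => //; last by move=> x _; rewrite lee_fin.
exact: (measurable_int mu fi).
Qed.

(* Integrating the derivative of [phi^2 f g], with the cut-off [phi t = 1 - (t / r)^2]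
   vanishing at [r] and [- r], bounds the integral of [g^2] over the middle half. *)
Lemma caccioppoli f g h (r : R) : ac_with f g -> ac_with g h ->
  square_integrable f -> square_integrable h -> 1 <= r ->
  \int[mu]_(x in `[- (r / 2), r / 2]) (g x ^+ 2) <=
  36 * \int[mu]_x (f x ^+ 2 + h x ^+ 2).
Proof.
move=> hf hg L2f L2h r1; have r0 : 0 < r by lra.
pose c := r^-1 ^+ 2.
have hphi : ac_with (fun t : R => 1 - t * t * c) (fun t => - (2 * t * c)).
  have := acB (ac_cst 1) (acM (acM ac_id ac_id) (ac_cst c)).
  by congr ac_with; apply/funext => t; ring.
set phi := (fun t : R => 1 - _) in hphi; set dphi := (fun t : R => - _) in hphi.
have := acM (acM hphi hphi) (acM hf hg).
set D := (X in ac_with _ X) => -[lD DE].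
have rr : - r <= r by lra.
have cr : r * r * c = 1 by rewrite /c; field; lra.
have c0 : 0 <= c by exact: sqr_ge0.
have := DE _ _ rr.
rewrite {1 2 3 4}/phi mulrNN cr subrr !mul0r subrr => /esym D0.
have cphi := ac_continuous hphi; have cg := ac_continuous hg.
have lpg : locally_integrable setT (fun t => phi t ^+ 2 * g t ^+ 2).
  apply: continuous_locally_integrable => t.
  by apply: cvgM; exact: continuous_sqr.
have ifh : mu.-integrable setT (EFin \o (fun x => f x ^+ 2 + h x ^+ 2)).
  by apply: integrable_EFinD => //; exact: square_integrable_sqr.
have ifhr : mu.-integrable `[- r, r] (EFin \o (fun x => f x ^+ 2 + h x ^+ 2)).
  exact: integrableS ifh.
have ipgr := locally_integrable_itv (- r) r lpg.
(* Since [D] has integral 0, it is enough that phi^2 g^2 <= 18 (f^2 + h^2) + 2 D pointwise.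
   Completing the square with 4 phi phi' f g costs 4 phi'^2 f^2 <= 16 f^2, and 2 phi^2 f h costs at
   most f^2 + h^2; the total 17 is rounded up. *)
have half : \int[mu]_(x in `[- r, r]) (phi x ^+ 2 * g x ^+ 2) <=
    18 * \int[mu]_(x in `[- r, r]) (f x ^+ 2 + h x ^+ 2).
  rewrite -RintegralZl//.
  have i18 : mu.-integrable `[- r, r] (EFin \o (fun x => 18 * (f x ^+ 2 + h x ^+ 2))).
    exact: integrable_EFinZl.
  have i2D : mu.-integrable `[- r, r] (EFin \o (fun x => 2 * D x)).
    by apply: integrable_EFinZl => //; exact: locally_integrable_itv.
  rewrite -[leRHS]addr0 -(mulr0 2) -D0 -RintegralZl//; last exact: locally_integrable_itv.
  rewrite -RintegralD//; apply: le_Rintegral => //.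
    exact: integrable_EFinD.
  move=> x; rewrite /= in_itv /= => /andP[rx xr].
  have phi1 : phi x ^+ 2 <= 1.
    have : 0 <= x * x * c by rewrite mulr_ge0// -expr2 sqr_ge0.
    have : x * x * c <= 1 by rewrite -cr ler_wpM2r//; nra.
    by rewrite /phi; nra.
  (* Here r >= 1 enters: it gives c <= 1, so that the bound on phi' does not depend on r. *)
  have dphi4 : dphi x ^+ 2 <= 4.
    have -> : dphi x ^+ 2 = 4 * (x * x * c * c) by rewrite /dphi; ring.
    have c1 : c <= 1 by rewrite -cr ler_peMl//; nra.
    have : x * x * c <= 1 by rewrite -cr ler_wpM2r//; nra.
    have : 0 <= x * x * c by rewrite mulr_ge0// -expr2 sqr_ge0.
    by nra.
  rewrite /D.
  move: (phi x) (dphi x) (f x) (g x) (h x) phi1 dphi4 => p d u v w p1 d4.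
  have e1 : 0 <= (p * v + 2 * d * u) ^+ 2 by exact: sqr_ge0.
  have e2 : d ^+ 2 * u ^+ 2 <= 4 * u ^+ 2 by rewrite ler_wpM2r// sqr_ge0.
  have e3 : p ^+ 2 * (u ^+ 2 + w ^+ 2) <= u ^+ 2 + w ^+ 2.
    by rewrite ler_piMl// addr_ge0// sqr_ge0.
  have e4 : 0 <= (p * (u + w)) ^+ 2 by exact: sqr_ge0.
  have := sqr_ge0 u; have := sqr_ge0 w.
  by nra.
(* The constant 36 is 2 times 18: on the middle half phi is at least 3/4, hence 1 <= 2 phi^2. *)
rewrite (@le_trans _ _ (2 * \int[mu]_(x in `[- r, r]) (phi x ^+ 2 * g x ^+ 2)))//; last first.
  apply: (@le_trans _ _ (2 * (18 * \int[mu]_(x in `[- r, r]) (f x ^+ 2 + h x ^+ 2)))).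
    by rewrite ler_wpM2l.
  rewrite mulrA -natrM ler_wpM2l//; apply: Rintegral_ge0_subset => //.
  by move=> x; rewrite addr_ge0// sqr_ge0.
have sub : `[- (r / 2), r / 2]%classic `<=` `[- r, r]%classic.
  by apply: subset_itv; rewrite bnd_simp; lra.
apply: (@le_trans _ _
  (2 * \int[mu]_(x in `[- (r / 2), r / 2]) (phi x ^+ 2 * g x ^+ 2))); last first.
  rewrite ler_wpM2l//; apply: Rintegral_ge0_subset => //.
  by move=> x; rewrite mulr_ge0// sqr_ge0.
rewrite -RintegralZl//; last exact: integrableS ipgr.
apply: le_Rintegral => //.
- apply: locally_integrable_itv; apply: continuous_locally_integrable.
  exact: continuous_sqr.
- by apply: integrable_EFinZl => //; exact: integrableS ipgr.
- move=> x; rewrite /= in_itv /= => /andP[rx xr].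
  have xc : x * x * c <= 1 / 4.
    have -> : 1 / 4 = (r / 2) * (r / 2) * c by transitivity (r * r * c / 4); [rewrite cr|field].
    by rewrite ler_wpM2r//; nra.
  have : 1 <= 2 * phi x ^+ 2 by rewrite /phi; nra.
  have := sqr_ge0 (g x); nra.
Qed.

(** The bound of [caccioppoli] is uniform in the radius, so monotone convergence along growing
    segments carries it to the whole line. *)
Lemma square_integrable_derivative f g h : ac_with f g -> ac_with g h ->
  square_integrable f -> square_integrable h -> square_integrable g.
Proof.
move=> hf hg L2f L2h; have mg := ac_measurable hg; split=> //.
pose F (n : nat) : set R := `[- n.+1%:R, n.+1%:R]%classic.
have cvgF := @ge0_nondecreasing_set_cvg_integral _ (measurableTypeR R) R F
  (fun x => (g x ^+ 2)%:E) mu.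
have FT : \bigcup_i F i = setT.
  apply/seteqP; split=> // x _; exists (Num.truncn `|x|) => //=.
  by rewrite /F /= in_itv /= -ler_norml ltW// truncnS_gt.
rewrite FT in cvgF.
pose K := 36 * \int[mu]_x (f x ^+ 2 + h x ^+ 2).
apply: (@le_lt_trans _ _ K%:E); last exact: ltry.
have {}cvgF : (\int[mu]_(x in F i) (g x ^+ 2)%:E @[i --> \oo] -->
    \int[mu]_x (g x ^+ 2)%:E)%E.
  apply: cvgF.
  - move=> m n mn; rewrite subsetEset; apply: subset_itv; rewrite bnd_simp.
      by rewrite lerN2 ler_nat ltnS.
    by rewrite ler_nat ltnS.
  - by move=> i; exact: measurable_itv.
  - by move=> i; exact: measurable_EFin_sqr.
  - by move=> i x _; rewrite lee_fin sqr_ge0.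
rewrite -(cvg_lim _ cvgF)//; apply: lime_le; first by apply/cvg_ex; eexists; exact: cvgF.
apply: nearW => n; rewrite /F.
(* The radius is 2 (n + 1), whose middle half is [F n]; the successor keeps it at least 1. *)
have n1 : 1 <= 2 * n.+1%:R :> R by rewrite -natrM ler1n.
have := caccioppoli hf hg L2f L2h n1.
rewrite mulrAC divff// mul1r -lee_fin EFin_Rintegral//.
apply: locally_integrable_itv; apply: continuous_locally_integrable.
exact/continuous_sqr/(ac_continuous hg).
Qed.

End SquareIntegrable.

(** * Complex arithmetic through real and imaginary parts *)

Section ComplexParts.
Context {R : realType}.
Implicit Types x y : R[i].

Lemma Re_complexD x y : complex.Re (x + y) = complex.Re x + complex.Re y.
Proof. by case: x; case: y. Qed.
Lemma Im_complexD x y : complex.Im (x + y) = complex.Im x + complex.Im y.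
Proof. by case: x; case: y. Qed.
Lemma Re_complexM x y : complex.Re (x * y) =
  complex.Re x * complex.Re y - complex.Im x * complex.Im y.
Proof. by case: x; case: y. Qed.
Lemma Im_complexM x y : complex.Im (x * y) =
  complex.Re x * complex.Im y + complex.Im x * complex.Re y.
Proof. by case: x; case: y. Qed.
Lemma Re_conjc x : complex.Re (conjc x) = complex.Re x.
Proof. by case: x. Qed.
Lemma Im_conjc x : complex.Im (conjc x) = - complex.Im x.
Proof. by case: x. Qed.
Lemma complex_ext x y : complex.Re x = complex.Re y ->
  complex.Im x = complex.Im y -> x = y.
Proof. by case: x => a b; case: y => c d /= -> ->. Qed.

Lemma iC_sqr : iC R * iC R = -1.
Proof. by apply: complex_ext; rewrite /= ?mul0r ?mul1r ?mulr0 ?sub0r ?addr0 ?oppr0. Qed.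

End ComplexParts.

(** * Absolute continuity and L^2 for complex-valued functions *)

Section ComplexAC.
Context {R : realType}.
Local Notation mu := (@lebesgue_measure R).
Implicit Types f g df dg : R -> R[i].

Lemma acl_derivE f df : acl_deriv f df <->
  ac_with (fun x => complex.Re (f x)) (fun x => complex.Re (df x)) /\
  ac_with (fun x => complex.Im (f x)) (fun x => complex.Im (df x)).
Proof.
split=> [[[lr li] fE]|[[lr rE] [li iE]]].
  split; split=> // a b /fE; case: (f b) (f a) => [u v] [w z].
    by move=> /(congr1 (@complex.Re R)).
  by move=> /(congr1 (@complex.Im R)).
split=> // a b ab; apply: complex_ext; rewrite /cint /=.
  by rewrite -rE//; case: (f b) (f a) => [u v] [w z].
by rewrite -iE//; case: (f b) (f a) => [u v] [w z].
Qed.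

Lemma acl_deriv_ext f g df dg : acl_deriv f df -> f =1 g -> df =1 dg ->
  acl_deriv g dg.
Proof. by move=> h /funext <- /funext <-. Qed.

Lemma acl_deriv_cst (c : R[i]) : acl_deriv (fun=> c) (fun=> 0).
Proof. by apply/acl_derivE; split; exact: ac_cst. Qed.

Lemma acl_derivD f g df dg : acl_deriv f df -> acl_deriv g dg ->
  acl_deriv (fun x => f x + g x) (fun x => df x + dg x).
Proof.
move=> /acl_derivE[fr fi] /acl_derivE[gr gi]; apply/acl_derivE; split.
  have := acD fr gr.
  by congr ac_with; apply/funext => x; rewrite Re_complexD.
have := acD fi gi.
by congr ac_with; apply/funext => x; rewrite Im_complexD.
Qed.

Lemma acl_derivM f g df dg : acl_deriv f df -> acl_deriv g dg ->
  acl_deriv (fun x => f x * g x) (fun x => df x * g x + f x * dg x).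
Proof.
move=> /acl_derivE[fr fi] /acl_derivE[gr gi]; apply/acl_derivE; split.
  have := acB (acM fr gr) (acM fi gi).
  by congr ac_with; apply/funext => x; rewrite ?Re_complexD !Re_complexM//; ring.
have := acD (acM fr gi) (acM fi gr).
by congr ac_with; apply/funext => x; rewrite ?Im_complexD !Im_complexM//; ring.
Qed.

Lemma acl_derivZ (c : R[i]) f df : acl_deriv f df ->
  acl_deriv (fun x => c * f x) (fun x => c * df x).
Proof.
move=> hf; apply: acl_deriv_ext (acl_derivM (acl_deriv_cst c) hf) _ _ => //.
by move=> x; rewrite mul0r add0r.
Qed.

Lemma acl_deriv_conj f df : acl_deriv f df ->
  acl_deriv (fun x => conjc (f x)) (fun x => conjc (df x)).
Proof.
move=> /acl_derivE[fr fi]; apply/acl_derivE; split.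
  by have := fr; congr ac_with; apply/funext => x; rewrite Re_conjc.
have := acN fi.
by congr ac_with; apply/funext => x; rewrite Im_conjc.
Qed.

Lemma acl_deriv_sum (I : finType) (f df : I -> R -> R[i]) :
  (forall i, acl_deriv (f i) (df i)) ->
  acl_deriv (fun x => \sum_i f i x) (fun x => \sum_i df i x).
Proof.
move=> h; elim: (index_enum I) => [|i s IH].
  by apply: acl_deriv_ext (acl_deriv_cst 0) _ _ => x; rewrite big_nil.
apply: acl_deriv_ext (acl_derivD (h i) IH) _ _ => x;
  by rewrite big_cons.
Qed.

Lemma acl_deriv0_cst f x y : acl_deriv f (fun=> 0) -> f x = f y.
Proof.
have wlog a b : a <= b -> acl_deriv f (fun=> 0) -> f b = f a.
  move=> ab [_ /(_ a b ab)]; rewrite /cint /= => /eqP.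
  by rewrite subr_eq !Rintegral_cst// mul0r => /eqP ->; rewrite add0r.
by have [/wlog h /h|/ltW/wlog h /h] := leP x y.
Qed.

Definition cmeasurable f :=
  measurable_fun setT (fun x => complex.Re (f x)) /\
  measurable_fun setT (fun x => complex.Im (f x)).

Lemma acl_deriv_measurable f df : acl_deriv f df -> cmeasurable f.
Proof. by move=> /acl_derivE[/ac_measurable ? /ac_measurable]. Qed.

Lemma acl_deriv_measurable_derivative f df : acl_deriv f df -> cmeasurable df.
Proof. by move=> [[[? _ _] [? _ _]] _]. Qed.

Lemma cmeasurableZ (c : R[i]) f : cmeasurable f -> cmeasurable (fun x => c * f x).
Proof.
move=> [mr mi]; split.
  under eq_fun do rewrite Re_complexM.
  by apply: measurable_funB; apply: measurable_funM.
under eq_fun do rewrite Im_complexM.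
by apply: measurable_funD; apply: measurable_funM.
Qed.

Lemma acl_deriv_ae f df dg : acl_deriv f df -> cmeasurable dg ->
  {ae mu, forall x, df x = dg x} -> acl_deriv f dg.
Proof.
move=> /acl_derivE[fr fi] [mr mi] dfg; apply/acl_derivE; split.
  by apply: ac_ae fr _ _ => //; apply: ae_mono dfg => x ->.
by apply: ac_ae fi _ _ => //; apply: ae_mono dfg => x ->.
Qed.

Lemma L2cE f : L2c f <->
  square_integrable (fun x => complex.Re (f x)) /\
  square_integrable (fun x => complex.Im (f x)).
Proof.
have E : measurable_fun setT (fun x => complex.Re (f x)) ->
    measurable_fun setT (fun x => complex.Im (f x)) ->
    (\int[mu]_x ((complex.Re (f x)) ^+ 2 + (complex.Im (f x)) ^+ 2)%:E =
     \int[mu]_x ((complex.Re (f x)) ^+ 2)%:E +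
     \int[mu]_x ((complex.Im (f x)) ^+ 2)%:E)%E.
  move=> mr mi; under eq_integral do rewrite EFinD.
  rewrite ge0_integralD//; try exact: measurable_EFin_sqr;
    by move=> x _; rewrite lee_fin sqr_ge0.
have ge0 (g : R -> R) : (0 <= \int[mu]_x (g x ^+ 2)%:E)%E.
  by apply: integral_ge0 => x _; rewrite lee_fin sqr_ge0.
split=> [[mr mi]|[[mr ir] [mi ii]]]; last by split=> //; rewrite E// lte_add_pinfty.
by rewrite E// => h; split; split=> //; apply: le_lt_trans h; rewrite ?leeDl ?leeDr.
Qed.

Lemma L2cD f g : L2c f -> L2c g -> L2c (fun x => f x + g x).
Proof.
move=> /L2cE[fr fi] /L2cE[gr gi]; apply/L2cE; split.
  by under eq_fun do rewrite Re_complexD; exact: square_integrableD.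
by under eq_fun do rewrite Im_complexD; exact: square_integrableD.
Qed.

Lemma L2c_boundedM f g (K : R) : cmeasurable f -> (forall x, cabs (f x) <= K) ->
  L2c g -> L2c (fun x => f x * g x).
Proof.
move=> [mr mi] fK /L2cE[gr gi].
have rK x : `|complex.Re (f x)| <= K.
  apply: le_trans (fK x); rewrite /cabs; case: (f x) => a b /=.
  by rewrite -sqrtr_sqr ler_sqrt ?lerDl ?addr_ge0 ?sqr_ge0.
have iK x : `|complex.Im (f x)| <= K.
  apply: le_trans (fK x); rewrite /cabs; case: (f x) => a b /=.
  by rewrite -sqrtr_sqr ler_sqrt ?lerDr ?addr_ge0 ?sqr_ge0.
apply/L2cE; split.
  under eq_fun do rewrite Re_complexM; apply: square_integrableD.
    exact: square_integrable_boundedM.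
  by apply: square_integrableN; exact: square_integrable_boundedM.
under eq_fun do rewrite Im_complexM.
by apply: square_integrableD; exact: square_integrable_boundedM.
Qed.

Lemma L2cZ (c : R[i]) f : L2c f -> L2c (fun x => c * f x).
Proof.
by apply: (@L2c_boundedM (fun=> c) _ (cabs c)) => //.
Qed.

Lemma L2c_sum (I : finType) (f : I -> R -> R[i]) :
  (forall i, L2c (f i)) -> L2c (fun x => \sum_i f i x).
Proof.
move=> h; elim: (index_enum I) => [|i s IH].
  under eq_fun do rewrite big_nil.
  split=> //=.
  by under eq_integral do rewrite expr0n /= addr0; rewrite integral0.
by under eq_fun do rewrite big_cons; exact: L2cD.
Qed.

Lemma L2c_ae f g : cmeasurable g -> L2c f -> {ae mu, forall x, f x = g x} -> L2c g.
Proof.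
move=> [mr mi] /L2cE[fr fi] fg; apply/L2cE; split.
  by apply: square_integrable_ae fr _ => //; apply: ae_mono fg => x ->.
by apply: square_integrable_ae fi _ => //; apply: ae_mono fg => x ->.
Qed.

Lemma L2c_derivative f df ddf : acl_deriv f df -> acl_deriv df ddf ->
  L2c f -> L2c ddf -> L2c df.
Proof.
move=> /acl_derivE[fr fi] /acl_derivE[gr gi] /L2cE[Lr Li] /L2cE[Lr2 Li2].
by apply/L2cE; split;
  [exact: square_integrable_derivative fr gr _ _|exact: square_integrable_derivative fi gi _ _].
Qed.

End ComplexAC.

(** * Matrix-valued functions, unitary matrices and the matrix form of N(q) *)

Section MatrixAC.
Context {R : realType}.
Local Notation mu := (@lebesgue_measure R).
Local Notation V := 'cV[R[i]]_2.

Definition acl_deriv_mx m n (A dA : R -> 'M[R[i]]_(m, n)) :=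
  forall i j, acl_deriv (fun x => A x i j) (fun x => dA x i j).

Lemma acl_derivvE (F dF : R -> V) : acl_derivv F dF <-> acl_deriv_mx F dF.
Proof. by split=> h i; [move=> j; rewrite (ord1 j)|]; exact: h. Qed.

Lemma acl_deriv_mx_ext m n (A B dA dB : R -> 'M[R[i]]_(m, n)) :
  acl_deriv_mx A dA -> A =1 B -> dA =1 dB -> acl_deriv_mx B dB.
Proof. by move=> h /funext <- /funext <-. Qed.

(** Arbitrary shapes let one product rule serve both for matrix times matrix, as in the proof of
    unitarity, and for matrix times vector, as in the intertwining. *)
Lemma acl_deriv_mxM m n p (A dA : R -> 'M[R[i]]_(m, n))
    (B dB : R -> 'M[R[i]]_(n, p)) :
  acl_deriv_mx A dA -> acl_deriv_mx B dB ->
  acl_deriv_mx (fun x => A x *m B x) (fun x => dA x *m B x + A x *m dB x).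
Proof.
move=> hA hB i j.
have := acl_deriv_sum (fun k => acl_derivM (hA i k) (hB k j)).
by move=> /acl_deriv_ext; apply => x; rewrite !mxE// big_split.
Qed.

Lemma acl_deriv_adjmx (A dA : R -> 'M[R[i]]_2) : acl_deriv_mx A dA ->
  acl_deriv_mx (fun x => adjmx (A x)) (fun x => adjmx (dA x)).
Proof.
move=> hA i j; have /acl_deriv_ext := acl_deriv_conj (hA j i).
by apply=> x; rewrite !mxE.
Qed.

Lemma acl_derivv_ae (F dF G : R -> V) : acl_derivv F dF ->
  (forall i, cmeasurable (fun x => G x i ord0)) -> aeeq dF G -> acl_derivv F G.
Proof.
move=> hF mG FG i; apply: acl_deriv_ae (hF i) (mG i) _.
by apply: ae_mono FG => x ->.
Qed.

Lemma L2v_ae (F G : R -> V) : (forall i, cmeasurable (fun x => G x i ord0)) ->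
  L2v F -> aeeq F G -> L2v G.
Proof.
move=> mG LF FG i; apply: L2c_ae (mG i) (LF i) _.
by apply: ae_mono FG => x ->.
Qed.

Lemma acl_derivvZ (c : R[i]) (F dF : R -> V) : acl_derivv F dF ->
  acl_derivv (fun x => c *: F x) (fun x => c *: dF x).
Proof.
move=> hF i; have /acl_deriv_ext := acl_derivZ c (hF i).
by apply=> x; rewrite mxE.
Qed.

Lemma L2vZ (c : R[i]) (F : R -> V) : L2v F -> L2v (fun x => c *: F x).
Proof. by move=> LF i; under eq_fun do rewrite mxE; exact: L2cZ. Qed.

(** The map [h] may depend on the point, to cover multiplication by U(x) as well as the constant
    sign change. *)
Lemma aeeq_comp (h : R -> V -> V) (F G : R -> V) : aeeq F G ->
  aeeq (fun x => h x (F x)) (fun x => h x (G x)).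
Proof. by apply: ae_mono => x ->. Qed.

Lemma mulU_L2v (U : R -> 'M[R[i]]_2) (K : R) (F : R -> V) :
  (forall i j, cmeasurable (fun x => U x i j)) ->
  (forall x i j, cabs (U x i j) <= K) -> L2v F -> L2v (mulU U F).
Proof.
move=> mU UK LF i; under eq_fun do rewrite mxE.
by apply: L2c_sum => j; apply: (@L2c_boundedM _ _ _ K).
Qed.

Lemma adjmxM (A B : 'M[R[i]]_2) : adjmx (A *m B) = adjmx B *m adjmx A.
Proof. by rewrite /adjmx trmx_mul map_mxM. Qed.

(** The (j, j) entry of [adjmx A *m A = 1%:M] says that the squared moduli in column j sum to 1. *)
Lemma cabs_unitary (A : 'M[R[i]]_2) i j : unitary_mx A -> cabs (A i j) <= 1.
Proof.
move=> [/matrixP/(_ j j)]; rewrite !mxE eqxx => /(congr1 (@complex.Re R)) /=.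
have E k : complex.Re (adjmx A j k * A k j) =
    complex.Re (A k j) ^+ 2 + complex.Im (A k j) ^+ 2.
  by rewrite !mxE Re_complexM Re_conjc Im_conjc mulNr opprK !expr2.
rewrite (bigD1 i)//= Re_complexD E => A1 _.
have rest : 0 <= complex.Re (\sum_(k < 2 | k != i) adjmx A j k * A k j).
  elim/big_ind: _ => [//|x y x0 y0|k _]; first by rewrite Re_complexD addr_ge0.
  by rewrite E addr_ge0// sqr_ge0.
rewrite /cabs; case: (A i j) A1 => a b /= A1.
by rewrite -sqrtr1 ler_sqrt//; lra.
Qed.

Lemma adjmx_unitary (A : 'M[R[i]]_2) : unitary_mx A -> unitary_mx (adjmx A).
Proof.
move=> [h1 h2]; suff -> : unitary_mx (adjmx A) = (A *m adjmx A = 1%:M /\ adjmx A *m A = 1%:M).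
  by [].
rewrite /unitary_mx; suff -> : adjmx (adjmx A) = A by [].
by apply/matrixP => i j; rewrite !mxE; case: (A i j) => a b /=; rewrite opprK.
Qed.

Lemma adjmx_Aq (q : R -> R[i]) x : adjmx (Aq q x) = - Aq q x.
Proof.
apply/matrixP => [[[|[|//]]] i [[|[|//]] j]]; rewrite !mxE /=; case: (q x) => a b;
  by apply: complex_ext; rewrite /= ?oppr0 ?opprK.
Qed.

Lemma NopE (q : R -> R[i]) (F dF : R -> V) x :
  Nop q F dF x = iC R *: (dF x - Aq q x *m F x).
Proof.
rewrite /Nop /c0 /c1; congr (_ *: _); apply/matrixP => i j; rewrite (ord1 j).
rewrite !mxE !big_ord_recl big_ord0 !mxE /=.
have l0 : lift ord0 ord0 = ord_max :> 'I_2 by apply/val_inj.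
rewrite l0; case: i => [[|[|//]]] i /=.
  rewrite mul0r add0r addr0; congr (dF x _ _ - _).
  exact/val_inj.
rewrite mul0r !addr0 mulNr opprK addrC; congr (_ + dF x _ _).
exact/val_inj.
Qed.

End MatrixAC.

(** * Passing from M(-q) M(q) to the square of N(q) *)

Section SignFlip.
Context {R : realType}.
Local Notation V := 'cV[R[i]]_2.
Implicit Types (q : R -> R[i]) (F dF Y Z : R -> V).

(** Pointwise multiplication by the matrix s of the overview. *)
Definition sign_flip F : R -> V := fun x => col2 (c0 (F x)) (- c1 (F x)).

Lemma sign_flipE F x i :
  sign_flip F x i ord0 = (if i == ord0 then 1 else -1) * F x i ord0.
Proof.
rewrite mxE /c0 /c1; case: i => [[|[|//]]] i /=.
  by rewrite mul1r; congr (F x _ _); exact/val_inj.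
by rewrite mulN1r; congr (- F x _ _); exact/val_inj.
Qed.

Lemma sign_flipK F : sign_flip (sign_flip F) = F.
Proof.
apply/funext => x; apply/matrixP => i j; rewrite (ord1 j) !sign_flipE mulrA.
by case: ifP => _; rewrite ?mulrNN mulr1 mul1r.
Qed.

Lemma acl_derivv_sign_flip F dF : acl_derivv F dF ->
  acl_derivv (sign_flip F) (sign_flip dF).
Proof.
move=> hF i.
have /acl_deriv_ext := acl_derivZ (if i == ord0 then 1 else -1) (hF i).
by apply=> x; rewrite sign_flipE.
Qed.

Lemma L2v_sign_flip F : L2v F -> L2v (sign_flip F).
Proof. by move=> LF i; under eq_fun do rewrite sign_flipE; exact: L2cZ. Qed.

Lemma aeeq_sign_flip F Y : aeeq F Y -> aeeq (sign_flip F) (sign_flip Y).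
Proof. exact: (@aeeq_comp _ (fun _ v => col2 (c0 v) (- c1 v))). Qed.

Lemma Mop_flip q F dF : Mop q F dF = sign_flip (Nop q F dF).
Proof.
apply/funext => x; apply/matrixP => i j; rewrite (ord1 j) sign_flipE !mxE.
by case: ifP => _; rewrite ?mul1r// mulN1r -mulrN opprD mulNr.
Qed.

Lemma MopN_flip q F dF :
  Mop (fun x => - q x) F dF = Nop q (sign_flip F) (sign_flip dF).
Proof.
apply/funext => x; apply/matrixP => i j; rewrite (ord1 j) !mxE /c0 /c1 !sign_flipE /=.
rewrite !mulN1r !mul1r mulrN mulNr; congr (_ * _); case: ifP => // _.
by congr (_ * _ - _); case: (q x) => a b; apply: complex_ext; rewrite /= ?opprK.
Qed.

Lemma dexpr_Mop q F Y : dexpr (Mop q) F Y <-> dexpr (Nop q) F (sign_flip Y).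
Proof.
split=> -[dF [hF YE]]; exists dF; split=> //.
  by rewrite -[Nop _ _ _]sign_flipK -Mop_flip; exact: aeeq_sign_flip.
by rewrite -[Y]sign_flipK Mop_flip; exact: aeeq_sign_flip.
Qed.

Lemma dexpr_MopN q Y Z :
  dexpr (Mop (fun x => - q x)) Y Z <-> dexpr (Nop q) (sign_flip Y) Z.
Proof.
split=> -[dF [hF YE]]; exists (sign_flip dF); split.
- exact: acl_derivv_sign_flip.
- by rewrite -MopN_flip.
- by rewrite -[Y]sign_flipK; exact: acl_derivv_sign_flip.
- by rewrite MopN_flip sign_flipK.
Qed.

Lemma maxop_Mop q F Y :
  maxop (dexpr (Mop q)) F Y <-> maxop (dexpr (Nop q)) F (sign_flip Y).
Proof.
split=> -[LF LY [F0 [FE hF]]]; split=> //.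
- exact: L2v_sign_flip.
- by exists F0; split=> //; apply/dexpr_Mop.
- by rewrite -[Y]sign_flipK; exact: L2v_sign_flip.
- by exists F0; split=> //; apply/dexpr_Mop.
Qed.

Lemma maxop_MopN q Y Z :
  maxop (dexpr (Mop (fun x => - q x))) Y Z <->
  maxop (dexpr (Nop q)) (sign_flip Y) Z.
Proof.
split=> -[LY LZ [F0 [FE hF]]]; split=> //.
- exact: L2v_sign_flip.
- exists (sign_flip F0); split; first exact: aeeq_sign_flip.
  exact/dexpr_MopN.
- by rewrite -[Y]sign_flipK; exact: L2v_sign_flip.
- exists (sign_flip F0); split; last by apply/dexpr_MopN; rewrite sign_flipK.
  by rewrite -[Y]sign_flipK; exact: aeeq_sign_flip.
Qed.

(** M(-q) M(q) = N(q) s s N(q): the two sign changes meet at the intermediate function, so [Y] is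
    traded for [sign_flip Y]. *)
Lemma dexpr2_MopN_Mop q F Z :
  dexpr2 (Mop (fun x => - q x)) (Mop q) F Z <-> dexpr2 (Nop q) (Nop q) F Z.
Proof.
split=> -[Y [h1 h2]]; exists (sign_flip Y); split.
- exact/dexpr_Mop.
- exact/dexpr_MopN.
- by apply/dexpr_Mop; rewrite sign_flipK.
- by apply/dexpr_MopN; rewrite sign_flipK.
Qed.

(** The same exchange is compatible with the domains, because s preserves L^2 and almost everywhere
    equality. *)
Lemma opcomp_MopN_Mop q F Z :
  opcomp (maxop (dexpr (Mop (fun x => - q x)))) (maxop (dexpr (Mop q))) F Z <->
  opcomp (maxop (dexpr (Nop q))) (maxop (dexpr (Nop q))) F Z.
Proof.
split=> -[Y [h1 h2]]; exists (sign_flip Y); split.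
- exact/maxop_Mop.
- exact/maxop_MopN.
- by apply/maxop_Mop; rewrite sign_flipK.
- by apply/maxop_MopN; rewrite sign_flipK.
Qed.

End SignFlip.

(** * The free operators i d/dx and -d^2/dx^2 and their domains *)

Section FreeOperators.
Context {R : realType}.
Implicit Types F W : R -> 'cV[R[i]]_2.

Lemma acl_derivv_measurable F dF i :
  acl_derivv F dF -> cmeasurable (fun x => F x i ord0).
Proof. by move=> /(_ i) /acl_deriv_measurable. Qed.

Lemma acl_derivv_measurable_derivative F dF i :
  acl_derivv F dF -> cmeasurable (fun x => dF x i ord0).
Proof. by move=> /(_ i) /acl_deriv_measurable_derivative. Qed.

Lemma cmeasurablevZ (c : R[i]) F i : cmeasurable (fun x => F x i ord0) ->
  cmeasurable (fun x => (c *: F x) i ord0).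
Proof.
move=> mF; rewrite (_ : (fun x => _) = fun x => c * F x i ord0).
  exact: cmeasurableZ.
by apply/funext => x; rewrite mxE.
Qed.

Lemma scale_iC2 (v : 'cV[R[i]]_2) : iC R *: (iC R *: v) = - v.
Proof. by rewrite scalerA iC_sqr scaleN1r. Qed.

Lemma L2v_derivative F dF ddF : acl_derivv F dF -> acl_derivv dF ddF ->
  L2v F -> L2v ddF -> L2v dF.
Proof. by move=> hF hdF LF LddF i; exact: L2c_derivative (hF i) (hdF i) _ _. Qed.

Lemma maxop_iDop_H12 F : (exists W, maxop (dexpr (@iDop R)) F W) <-> H12 F.
Proof.
split=> [[W [LF LW [F0 [FE [dF [hF WE]]]]]]|[LF [F0 [dF [FE hF LdF]]]]].
  split=> //; exists F0, dF; split=> //.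
  apply: (@L2v_ae _ (fun x => - iC R *: W x)).
  - by move=> i; exact: acl_derivv_measurable_derivative hF.
  - exact: L2vZ.
  - by apply: ae_mono WE => x ->; rewrite scaleNr scale_iC2 opprK.
exists (fun x => iC R *: dF x); split=> //; first exact: L2vZ.
by exists F0; split=> //; exists dF; split=> //; exact: ae_mono FE.
Qed.

(** The gap between the two sides is F' in L^2, which [H22] demands and the maximal operator does
    not; [L2v_derivative] closes it. *)
Lemma maxop_d2expr_H22 F : (exists W, maxop (@d2expr R) F W) <-> H22 F.
Proof.
split=> [[W [LF LW [F0 [FE [dF [ddF [hF hdF WE]]]]]]]|].
  split=> //; exists F0, dF, ddF.
  have LddF : L2v ddF.
    apply: (@L2v_ae _ (fun x => -1 *: W x)).
    - by move=> i; exact: acl_derivv_measurable_derivative hdF.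
    - exact: L2vZ.
    - by apply: ae_mono WE => x ->; rewrite scaleN1r opprK.
  (* The derivative estimate must be applied to the absolutely continuous representative, so
     membership in L^2 is first moved from [F] to [F0]. *)
  have LF0 : L2v F0.
    by apply: L2v_ae FE => // i; exact: acl_derivv_measurable hF.
  by split=> //; exact: L2v_derivative hF hdF LF0 LddF.
move=> [LF [F0 [dF [ddF [FE hF hdF LdF LddF]]]]].
exists (fun x => -1 *: ddF x); split=> //; first exact: L2vZ.
exists F0; split=> //; exists dF, ddF; split=> //.
by apply: ae_mono FE => x _; rewrite scaleN1r.
Qed.

(** From left to right the derivative of [F0] has to be re-chosen as an absolutely continuous
    function. From right to left the intermediate function i F' has to lie in L^2, which again is
    the derivative estimate. *)
Lemma opcomp_iDop F W :
  opcomp (maxop (dexpr (@iDop R))) (maxop (dexpr (@iDop R))) F W <->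
  maxop (@d2expr R) F W.
Proof.
split=> [[Y [[LF LY [F0 [FE [dF0 [hF YE]]]]]]]|].
  move=> [_ LW [Y0 [YY0 [dY0 [hY WE]]]]]; split=> //; exists F0; split=> //.
  (* Almost everywhere i F0' = Y = Y0, so - i Y0 is a representative of F0' that can be
     differentiated once more. *)
  exists (fun x => - iC R *: Y0 x), (fun x => - iC R *: dY0 x); split.
  - apply: (acl_derivv_ae hF).
      by move=> i; apply: cmeasurablevZ; exact: acl_derivv_measurable hY.
    by apply: ae_mono2 YE YY0 => x -> <-; rewrite scaleNr scale_iC2 opprK.
  - exact: acl_derivvZ.
  - by apply: ae_mono WE => x ->; rewrite scaleNr opprK.
move=> [LF LW [F0 [FE [dF [ddF [hF hdF WE]]]]]].
have LddF : L2v ddF.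
  apply: (@L2v_ae _ (fun x => -1 *: W x)).
  - by move=> i; exact: acl_derivv_measurable_derivative hdF.
  - exact: L2vZ.
  - by apply: ae_mono WE => x ->; rewrite scaleN1r opprK.
have LF0 : L2v F0.
  by apply: L2v_ae FE => // i; exact: acl_derivv_measurable hF.
have LiDF : L2v (fun x => iC R *: dF x).
  by apply: L2vZ; exact: L2v_derivative hF hdF LF0 LddF.
exists (fun x => iC R *: dF x); split; split=> //.
  by exists F0; split=> //; exists dF; split=> //; exact: ae_mono FE.
exists (fun x => iC R *: dF x); split; first exact: ae_mono FE.
exists (fun x => iC R *: ddF x); split; first exact: acl_derivvZ.
by apply: ae_mono WE => x ->; rewrite /iDop scale_iC2.
Qed.

End FreeOperators.

(** * Conjugation by the fundamental solution U *)

Section Intertwining.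
Context {R : realType}.
Implicit Types F G W : R -> 'cV[R[i]]_2.
Context (q : R -> R[i]) (U : R -> 'M[R[i]]_2) (U0 : U 0 = 1%:M).
Context (hU : acl_deriv_mx U (fun x => Aq q x *m U x)).

Let Us x := adjmx (U x).

(** The adjoint of U' = A U, with the adjoint of A equal to - A. It makes the inverse of U available
    to the product rule. *)
Let hUs : acl_deriv_mx Us (fun x => - (Us x *m Aq q x)).
Proof.
have := acl_deriv_adjmx hU; congr (acl_deriv_mx Us _).
by apply/funext => x; rewrite adjmxM adjmx_Aq mulmxN.
Qed.

Lemma solution_unitary x : unitary_mx (U x).
Proof.
suff UsU : adjmx (U x) *m U x = 1%:M by split=> //; exact: mulmx1C.
transitivity (adjmx (U 0) *m U 0).
  apply/matrixP => i j.
  have /acl_deriv_ext h := acl_deriv_mxM hUs hU i j.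
  apply: (@acl_deriv0_cst _ (fun x => (adjmx (U x) *m U x) i j)).
  by apply: h => // y; rewrite mulNmx mulmxA addNr mxE.
rewrite U0 mulmx1; apply/matrixP => i j; rewrite !mxE eq_sym.
by case: (i == j); apply: complex_ext; rewrite /= ?oppr0.
Qed.

Let UsU F : mulU Us (mulU U F) = F.
Proof.
by apply/funext => x; rewrite /mulU mulmxA (solution_unitary x).1 mul1mx.
Qed.

Let UUs F : mulU U (mulU Us F) = F.
Proof.
by apply/funext => x; rewrite /mulU mulmxA (solution_unitary x).2 mul1mx.
Qed.

Let L2v_U F : L2v F -> L2v (mulU U F).
Proof.
apply: (@mulU_L2v _ _ 1) => [i j|x i j]; first exact: acl_deriv_measurable (hU i j).
exact/cabs_unitary/solution_unitary.
Qed.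

Let L2v_Us F : L2v F -> L2v (mulU Us F).
Proof.
apply: (@mulU_L2v _ _ 1) => [i j|x i j]; first exact: acl_deriv_measurable (hUs i j).
exact/cabs_unitary/adjmx_unitary/solution_unitary.
Qed.

(** The product rule turns (U F)' into A U F + U F', and the first term is cancelled by the
    potential in N(q). *)
Lemma dexpr_Nop_mulU F W :
  dexpr (Nop q) (mulU U F) (mulU U W) <-> dexpr (@iDop R) F W.
Proof.
split=> -[dF [/acl_derivvE hF WE]].
  (* Here only the derivative of U F is given; F is recovered as [Us] times U F, and this is its
     derivative by the product rule with [hUs]. *)
  exists (fun x => Us x *m (dF x - Aq q x *m mulU U F x)); split.
    apply/acl_derivvE; have := acl_deriv_mxM hUs hF.
    move=> /acl_deriv_mx_ext; apply=> x.
      exact: (congr1 (@^~ x) (UsU F)).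
    by rewrite mulmxBr mulNmx addrC -mulmxA.
  apply: ae_mono WE => x; rewrite NopE => /(congr1 (mulmx (Us x))).
  by rewrite -[LHS]/(mulU Us (mulU U W) x) UsU -scalemxAr.
have hUF := acl_deriv_mxM hU hF.
exists (fun x => Aq q x *m U x *m F x + U x *m dF x); split; first exact/acl_derivvE.
apply: ae_mono WE => x WE; rewrite NopE /mulU WE /iDop -scalemxAr -mulmxA.
by rewrite addrAC subrr add0r.
Qed.

(** Unitarity bounds the entries of U and of its adjoint by 1, so both preserve L^2 and the
    absolutely continuous representative can be moved either way. *)
Lemma maxop_Nop_mulU F W :
  maxop (dexpr (Nop q)) (mulU U F) (mulU U W) <-> maxop (dexpr (@iDop R)) F W.
Proof.
split=> -[LF LW [G0 [FE hG]]].
  split; [by rewrite -(UsU F); exact: L2v_Us|by rewrite -(UsU W); exact: L2v_Us|].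
  exists (mulU Us G0); split; last by apply/dexpr_Nop_mulU; rewrite UUs.
  by rewrite -(UsU F); exact: (@aeeq_comp _ (fun x v => Us x *m v)).
split; [exact: L2v_U|exact: L2v_U|].
exists (mulU U G0); split; last exact/dexpr_Nop_mulU.
exact: (@aeeq_comp _ (fun x v => U x *m v)).
Qed.

Lemma opcomp_Nop_mulU F W :
  opcomp (maxop (dexpr (Nop q))) (maxop (dexpr (Nop q))) (mulU U F) (mulU U W) <->
  opcomp (maxop (dexpr (@iDop R))) (maxop (dexpr (@iDop R))) F W.
Proof.
split=> -[Y [h1 h2]].
  by exists (mulU Us Y); split; apply/maxop_Nop_mulU; rewrite UUs.
by exists (mulU U Y); split; apply/maxop_Nop_mulU.
Qed.

End Intertwining.

Theorem theorem3p3 (R : realType) (q : R -> R[i]) (hq : loc_int q)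
  (U : R -> 'M[R[i]]_2) (hU0 : U 0 = 1%:M)
  (hU : forall i j : 'I_2,
     acl_deriv (fun x => U x i j) (fun x => (Aq q x *m U x) i j)) :
  (* (i)  M(-q) M(q) = N(q)^2 as differential expressions *)
  (forall F Z : R -> 'cV[R[i]]_2,
     dexpr2 (Mop (fun x => - q x)) (Mop q) F Z <-> dexpr2 (Nop q) (Nop q) F Z)
  /\
  (* (ii) U_q unitary, entries in AC_loc (hypothesis hU) and L^infty,
          U_q^{-1} N(q) U_q = i d/dx I_2 *)
  [/\ forall x, unitary_mx (U x),
      exists K : R, forall x (i j : 'I_2), cabs (U x i j) <= K &
      forall F W : R -> 'cV[R[i]]_2,
        dexpr (Nop q) (mulU U F) (mulU U W) <-> dexpr (@iDop R) F W]
  /\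
  (* (iii) unitary equivalences of the maximal operators *)
  [/\ forall F W : R -> 'cV[R[i]]_2,
        maxop (dexpr (Nop q)) (mulU U F) (mulU U W) <->
        maxop (dexpr (@iDop R)) F W,
      forall F : R -> 'cV[R[i]]_2,
        (exists W, maxop (dexpr (@iDop R)) F W) <-> H12 F,
      forall F W : R -> 'cV[R[i]]_2,
        opcomp (maxop (dexpr (Mop (fun x => - q x))))
               (maxop (dexpr (Mop q))) (mulU U F) (mulU U W) <->
        maxop (@d2expr R) F W &
      forall F : R -> 'cV[R[i]]_2,
        (exists W, maxop (@d2expr R) F W) <-> H22 F].
Proof.
split; first exact: dexpr2_MopN_Mop.
split.
  split; [exact: solution_unitary hU0 hU| |exact: dexpr_Nop_mulU hU0 hU].
  by exists 1 => x i j; apply/cabs_unitary/solution_unitary/hU.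
split; [exact: maxop_Nop_mulU hU0 hU|exact: maxop_iDop_H12| |exact: maxop_d2expr_H22].
(* The sign change reduces the claim to the square of N(q), conjugation to the square of i d/dx, and
   the latter is the maximal operator of -d^2/dx^2. *)
move=> F W; apply: iff_trans (opcomp_MopN_Mop _ _ _) _.
by apply: iff_trans (opcomp_iDop F W); exact: opcomp_Nop_mulU hU0 hU _ _.
Qed.
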